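(* Let $p, r$ be distinct odd primes such that $p<r$ and $p$ is a primitive root modulo $r$. Let $N=\mathbb{Z}_p^{r-1}$ (row vectors) and let $\sigma,\varphi\in\mathrm{GL}_{r-1}(p)$ be the matrices defined as follows: $\sigma$ is the companion matrix of $f(X)=X^{r-1}+X^{r-2}+\cdots+X+1\in\mathbb{Z}_p[X]$, namely the matrix whose first row is $(0,\dots,0,-1)$, and whose last column has all entries $-1$, whose subdiagonal entries (positions $(i+1,i)$, $1\le i\le r-2$) are $1$, and whose other entries are $0$; and $\varphi$ is the matrix with all antidiagonal entries $-1$ (positions $(i,r-i)$, $1\le i\le r-1$) and all other entries $0$. Then $\langle\sigma,\varphi\rangle\cong D_r$. Let $G:=N\rtimes\langle\sigma,\varphi\rangle$, with $\langle\sigma,\varphi\rangle$ acting on $N$ by right multiplication, let $n:=(1,0,\dots,0)\in N$, $g:=n\sigma\in G$, $s:=\varphi$, $S:=\langle s\rangle\cong\mathbb{Z}_2$, and $\Gamma:=\mathrm{Cos}(G,S,g)$. Then $(\Gamma,G)\in\mathcal{OG}(4)$ and $(\Gamma,G)$ is basic of unoriented-cycle type. Moreover, $N$ is the unique minimal normal subgroup of $G$, $N\cong\mathbb{Z}_p^{r-1}$, and $\Gamma_N\cong\mathbf{C}_r$.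
   Context: All groups and graphs are finite; graphs are simple and undirected. For a group $G$, a proper subgroup $S<G$ and $g\in G\setminus S$, the coset graph $\mathrm{Cos}(G,S,g)$ has vertex set $\{Sx: x\in G\}$, with $\{Sx,Sy\}$ an edge iff $xy^{-1}\in SgS$ or $yx^{-1}\in SgS$; $G$ acts on it by right multiplication, and $(\Gamma,G)$ refers to this action (so $(\Gamma,G)\in\mathcal{OG}(4)$ includes that the action is faithful). $D_r$ is the dihedral group of order $2r$. In the group $N\rtimes\langle\sigma,\varphi\rangle$, conjugation satisfies $v^{x}=x^{-1}vx = $ the row vector $v$ multiplied on the right by the matrix $x$. For $G\le \mathrm{Aut}(\Gamma)$, $\Gamma$ is $G$-oriented if $G$ is transitive on the vertices and on the edges of $\Gamma$ but not on the arcs (ordered pairs of adjacent vertices). $\mathcal{OG}(4)$ is the set of pairs $(\Gamma,G)$ with $\Gamma$ a connected $4$-valent graph, $G\leq \mathrm{Aut}(\Gamma)$, and $\Gamma$ $G$-oriented. For $N\unlhd G$, the $G$-normal quotient $\Gamma_N$ is the graph whose vertices are the $N$-orbits on $V\Gamma$, two distinct $N$-orbits being adjacent iff there is an edge of $\Gamma$ between a vertex of one and a vertex of the other. $\tilde N$ denotes the kernel of the action of $G$ on the set of $N$-orbits. $\mathbf{C}_r$ ($r\ge 3$) is the cycle graph with $r$ vertices. $(\Gamma,G)\in\mathcal{OG}(4)$ is basic if $\Gamma_N$ is isomorphic to $K_1$, $K_2$ or some $\mathbf{C}_m$ ($m\geq 3$) for every nontrivial normal subgroup $N$ of $G$. A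 cyclic normal quotient is a $\Gamma_N$ isomorphic to some $\mathbf{C}_m$, $m\ge3$; it is $G$-oriented if $G/\tilde N\cong C_m$ and $G$-unoriented if $G/\tilde N\cong D_m$. Two cyclic normal quotients $\Gamma_M,\Gamma_N$ are independent if $\Gamma_K$, with $K=\tilde M\cap\tilde N$, is not a cycle. $(\Gamma,G)$ is basic of unoriented-cycle type if it is basic, has at least one cyclic normal quotient, has no independent cyclic normal quotients, and all its cyclic normal quotients are $G$-unoriented. *)

(* Defs.v *)
From HB Require Import structures.
From mathcomp Require Import all_boot all_fingroup all_algebra.
From mathcomp Require Import all_solvable all_character.

Set Implicit Arguments.
Unset Strict Implicit.
Unset Printing Implicit Defensive.

Import GRing.Theory.
Local Open Scope group_scope.

(** * Finite simple graphs *)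

(* The vertex set is a subset of a finite type, so that for instance the right *)
(* cosets of a subgroup can serve as vertices.                                 *)
Record graph (T : finType) := Graph { vset : {set T}; adj : rel T }.

Definition simple_graph (T : finType) (Gam : graph T) : Prop :=
  [/\ forall x y, adj Gam x y -> (x \in vset Gam) && (y \in vset Gam),
      symmetric (adj Gam)
    & irreflexive (adj Gam)].

Definition edges (T : finType) (Gam : graph T) : {set {set T}} :=
  [set [set xy.1; xy.2] | xy : T * T & adj Gam xy.1 xy.2].

Definition connected_graph (T : finType) (Gam : graph T) : Prop :=
  {in vset Gam &, forall x y, connect (adj Gam) x y}.

Definition valent (k : nat) (T : finType) (Gam : graph T) : Prop :=
  {in vset Gam, forall x, #|[set y | adj Gam x y]| = k}.

Definition graph_isog (T1 T2 : finType) (Gam1 : graph T1) (Gam2 : graph T2) :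
    Prop :=
  exists f : T1 -> T2,
    [/\ {in vset Gam1 &, injective f},
        f @: vset Gam1 = vset Gam2
      & {in vset Gam1 &, forall x y, adj Gam2 (f x) (f y) = adj Gam1 x y}].

Definition complete_graph (m : nat) : graph 'I_m :=
  Graph [set: 'I_m] (fun i j => i != j).

(* [ordS] is the successor modulo [m]; only used for [3 <= m]. *)
Definition cycle_graph (m : nat) : graph 'I_m :=
  Graph [set: 'I_m] (fun i j => (ordS i == j) || (ordS j == i)).

Definition is_cycle (T : finType) (Gam : graph T) : Prop :=
  exists2 m, 2 < m & graph_isog Gam (cycle_graph m).

(** * Oriented graph actions and normal quotients *)

Section GraphActions.

Variables (T : finType) (aT : finGroupType).
Variables (Gam : graph T) (G : {group aT}) (to : {action aT &-> T}).

(* [G], acting via [to], is a subgroup of the automorphism group of [Gam]. *)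
Definition acts_as_automorphisms : Prop :=
  [/\ [acts G, on vset Gam | to],
      [faithful G, on vset Gam | to]
    & {in G, forall a, {in vset Gam &, forall x y,
        adj Gam (to x a) (to y a) = adj Gam x y}}].

Definition arc_transitive : Prop :=
  forall x y x' y', adj Gam x y -> adj Gam x' y' ->
    exists2 a, a \in G & to x a = x' /\ to y a = y'.

Definition oriented : Prop :=
  [/\ [transitive G, on vset Gam | to],
      [transitive G, on edges Gam | to^*]
    & ~ arc_transitive].

Definition OG4 : Prop :=
  [/\ simple_graph Gam, connected_graph Gam, valent 4 Gam,
      acts_as_automorphisms & oriented].

Definition normal_quotient (N : {set aT}) : graph {set T} :=
  let V := orbit to N @: vset Gam in
  Graph V (fun A B => [&& A \in V, B \in V, A != B
                        & [exists x in A, exists y in B, adj Gam x y]]).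

Definition quotient_kernel (N : {set aT}) : {group aT} :=
  'C_G(vset (normal_quotient N) | to^*)%G.

Definition basic : Prop :=
  forall N : {group aT}, N <| G -> N :!=: 1 ->
    [\/ graph_isog (normal_quotient N) (complete_graph 1),
        graph_isog (normal_quotient N) (complete_graph 2)
      | is_cycle (normal_quotient N)].

Definition cyclic_normal_quotient (N : {group aT}) : Prop :=
  N <| G /\ is_cycle (normal_quotient N).

(* ['D_(m.*2)] is the dihedral group of order [2 m]. *)
Definition unoriented_quotient (N : {group aT}) : Prop :=
  exists m, [/\ 2 < m, graph_isog (normal_quotient N) (cycle_graph m)
              & G / quotient_kernel N \isog 'D_(m.*2)].

Definition independent_quotients (M N : {group aT}) : Prop :=
  ~ is_cycle (normal_quotient (quotient_kernel M :&: quotient_kernel N)).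

Definition basic_unoriented_cycle_type : Prop :=
  [/\ OG4 /\ basic,
      exists N : {group aT}, cyclic_normal_quotient N,
      forall M N : {group aT}, cyclic_normal_quotient M ->
        cyclic_normal_quotient N -> ~ independent_quotients M N
    & forall N : {group aT}, cyclic_normal_quotient N -> unoriented_quotient N].

End GraphActions.

(* Meant for [S] a proper subgroup of [G] and [g \in G :\: S]; without the     *)
(* latter, this relation is not irreflexive.                                   *)
Definition coset_graph (gT : finGroupType) (G S : {set gT}) (g : gT) :
    graph {set gT} :=
  Graph (rcosets S G)
    (fun A B => [exists x in G, exists y in G,
       [&& A == S :* x, B == S :* y
         & (x * y^-1 \in S :* g * S) || (y * x^-1 \in S :* g * S)]]).

Definition min_normal_subgroup (gT : finGroupType) (G M : {group gT}) : Prop :=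
  M <| G /\ minnormal M G.

(** * The matrices and the semidirect product *)

(* Indices run over ['I_d.+1] (from [0]), to be used with [d.+1 = r - 1]. *)

Definition sigma_mx (R : comUnitRingType) (d : nat) : 'M[R]_d.+1 :=
  (\matrix_(i, j) if j == ord_max then -1 else (i == j.+1 :> nat)%:R)%R.

Definition phi_mx (R : comUnitRingType) (d : nat) : 'M[R]_d.+1 :=
  (\matrix_(i, j) if (i + j == d)%N then -1 else 0)%R.

Lemma sigma_mx_unit (R : comUnitRingType) (d : nat) :
  sigma_mx R d \is a GRing.unit.
Proof.
pose tau : 'M[R]_d.+1 :=
  (\matrix_(i, j) if j == ord0 then -1 else (j == i.+1 :> nat)%:R)%R.
suff tau_sigma : (tau *m sigma_mx R d = 1%:M)%R by case: (mulmx1_unit tau_sigma).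
apply/matrixP=> i k; rewrite !mxE (bigD1 ord0) //= !mxE eqxx mulN1r.
have [lt_id | ge_id] := ltnP i d.
  have lt_i1 : (i.+1 < d.+1)%N by [].
  rewrite (bigD1 (Ordinal lt_i1)) //= big1 => [|j /andP[j_n0 j_ni]]; last first.
    by rewrite !mxE (negPf j_n0) -val_eqE in j_ni *; rewrite (negPf j_ni) mul0r.
  rewrite !mxE /= eqxx mul1r addr0 eqSS.
  have [-> | _] := eqVneq k ord_max; last by rewrite oppr0 add0r val_eqE.
  by rewrite opprK subrr -val_eqE /= ltn_eqF.
have def_i : i = ord_max by apply/val_inj/eqP; rewrite eqn_leq ge_id -ltnS ltn_ord.
rewrite big1 => [|j j_n0]; last first.
  by rewrite !mxE (negPf j_n0) def_i /= ltn_eqF ?mul0r.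
rewrite addr0 def_i eq_sym; case: eqP => _; first by rewrite opprK.
by rewrite oppr0.
Qed.

Lemma phi_mx_unit (R : comUnitRingType) (d : nat) :
  phi_mx R d \is a GRing.unit.
Proof.
suff phi2 : (phi_mx R d *m phi_mx R d = 1%:M)%R by case: (mulmx1_unit phi2).
apply/matrixP=> i k; have le_id : (i <= d)%N by rewrite -ltnS.
rewrite !mxE (bigD1 (rev_ord i)) //= !mxE big1 => [|j j_ni].
  rewrite /= subSS subnKC // eqxx addr0 mulN1r -val_eqE /=.
  have -> : (d - i + k == d)%N = (i == k :> nat).
    by rewrite -(eqn_add2l (d - i) i) subnK // eq_sym.
  by case: eqP => _; rewrite ?opprK ?oppr0.
rewrite !mxE; case: eqP => [def_d | _]; last by rewrite mul0r.
case/eqP: j_ni; apply/val_inj; rewrite /= subSS; apply/eqP.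
by rewrite -(eqn_add2l i) subnKC // def_d.
Qed.

Section Construction.

Variables p r : nat.

(* The dimension is [r.-2.+1], which is [r - 1] as soon as [2 <= r], and is    *)
(* convertible to the dimension [r.-1.-1.+1] of [{'GL_(r.-1)(p)}].             *)

Definition sigma : {'GL_(r.-1)(p)} :=
  FinRing.unit 'M['F_p]_(r.-2.+1) (sigma_mx_unit 'F_p r.-2).

Definition phi : {'GL_(r.-1)(p)} :=
  FinRing.unit 'M['F_p]_(r.-2.+1) (phi_mx_unit 'F_p r.-2).

Definition Hgrp : {group {'GL_(r.-1)(p)}} := <<[set sigma; phi]>>%G.

(* Right multiplication of row vectors by matrices in [Hgrp]. *)
Definition rowact : groupAction Hgrp [set: 'rV['F_p]_(r.-2.+1)] :=
  ('MR (GLrepr 'F_p r.-2) \ subsetT Hgrp)%gact.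

(* In [sdprod_by], conjugation of [sdpair1 rowact v] by [sdpair2 rowact x] is  *)
(* [sdpair1 rowact (rowact v x)], see [sdpair_act].                            *)
Definition gtype : finGroupType := sdprod_by rowact.

Definition Ggrp : {group gtype} := [set: gtype]%G.

Definition Ngrp : {group gtype} :=
  (sdpair1 rowact @* [set: 'rV['F_p]_(r.-2.+1)])%G.

Definition nvec : 'rV['F_p]_(r.-2.+1) := delta_mx ord0 ord0.

Definition gelt : gtype := sdpair1 rowact nvec * sdpair2 rowact sigma.

Definition selt : gtype := sdpair2 rowact phi.

Definition Sgrp : {group gtype} := <[selt]>%G.

Definition Gamma : graph {set gtype} := coset_graph Ggrp Sgrp gelt.

End Construction.

(* Main.v *)
Require Import Defs.
From mathcomp Require Import all_boot all_fingroup all_algebra.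
From mathcomp Require Import all_solvable all_character.
Import GRing.Theory.

Set Implicit Arguments.
Unset Strict Implicit.
Unset Printing Implicit Defensive.

(** Write [x] and [s] for the images in [G] of the matrices [sigma] and [phi],
    [n] for the first basis vector of [N], and [S = <s>].  Everything rests on
    three relations, [n ^ s = n ^ x], [x ^ s = x^-1] and [s ^+ 2 = 1], and on one
    arithmetic fact, the irreducibility of [N] under [x].

    The relations come from the orbit of the first basis vector under [sigma]:
    it consists of [r] vectors with sum zero that span [N] and that [sigma]
    permutes cyclically, while [phi] acts on it as a reflection of the [r]-gon.
    Hence [<sigma, phi>] is dihedral of order [2 r].

    Irreducibility ([primitive_root_irreducible]) is a counting argument, which
    replaces the factorisation of the cyclotomic polynomial modulo [p].  The
    element [x] has prime order [r] and fixes no nontrivial element of [N]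
    (a row fixed by [sigma] is killed by [r]), so a subgroup of [N] normalised by
    [x], of order [p ^ j] say, satisfies [p ^ j = 1] modulo [r].  As [p] is a
    primitive root modulo [r], [j] is [0] or [r - 1].

    The graph.  From [g = n x] and [g ^ s = x^-1 n] the neighbours of [S y] are
    [S n x y], [S n^-1 x y], [S x^-1 n y] and [S x^-1 n^-1 y] ([adj_nbrs]).  They
    are distinct: [x ^+ 2] is not in [S N], which separates the first two from the
    last two, and [n ^+ 2 != 1] separates [n] from [n^-1].  For the same reasons
    [g^-1] is not in [S g S], so the action is not arc-transitive.  The graph is
    connected: the subgroup generated by [S] and [g] contains
    [g * g ^ s = n ^+ 2], hence all of [N] by irreducibility, hence [x].

    The normal quotients.  For [M] normal in [G], the [M]-orbit of [S y] is the
    set of the cosets of [S] inside [S M y], so [Gamma_M] depends only on the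
    subgroup [S M] ([eq_normal_quotient]).  As [N] is irreducible and
    self-centralising, a nontrivial [M] contains [N], and [S N] has prime index
    [r] in [G]; therefore [S M] is [G] or [S N], and [Gamma_M] is a single vertex
    or equals [Gamma_N].  The orbits of [N] are represented by the powers of [x],
    and by the list of neighbours above the one of [x ^+ i] is adjacent to those
    of [x ^+ i.+1] and [x ^+ i.-1]: this is the cycle of length [r].  Finally
    [Gamma_1] has valency 4 and is no cycle.  So there is only one cyclic normal
    quotient; the kernel of [G] on it is [N], with [G / N] dihedral. *)

(** * The two matrices *)

Section Matrices.
Local Open Scope ring_scope.
Variables (R : comUnitRingType) (d : nat).
Local Notation sig := (sigma_mx R d).
Local Notation ph := (phi_mx R d).

(** Indexing the basis by [nat], with [unit_row k = 0] for [d < k], lets the orbit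
    of the last basis vector in [sigma_mx_expr] be given by one formula. *)
Definition unit_row (k : nat) : 'rV[R]_d.+1 := \row_j (j == k :> nat)%:R.
Local Notation e := unit_row.

Lemma unit_row_mul (A : 'M[R]_d.+1) k (lt_k : (k < d.+1)%N) :
  e k *m A = row (Ordinal lt_k) A.
Proof.
rewrite rowE; congr (_ *m A); apply/rowP=> j.
by rewrite !mxE eqxx -val_eqE.
Qed.

Lemma unit_row_sigma0 : e 0 *m sig = - e d.
Proof.
rewrite (unit_row_mul _ (ltn0Sn d)); apply/rowP=> j.
by rewrite !mxE -val_eqE /=; case: eqP => // _; rewrite oppr0.
Qed.

Lemma unit_row_sigmaS k : (k < d)%N -> e k.+1 *m sig = e k - e d.
Proof.
move=> lt_kd; have lt_k1 : (k.+1 < d.+1)%N by [].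
rewrite (unit_row_mul _ lt_k1); apply/rowP=> j.
rewrite !mxE -val_eqE /= eqSS; case: eqP => [->|_]; last by rewrite subr0 eq_sym.
by rewrite gtn_eqF // sub0r.
Qed.

Lemma unit_row_phi k : (k <= d)%N -> e k *m ph = - e (d - k).
Proof.
move=> le_kd; rewrite (unit_row_mul _ (le_kd : (k < d.+1)%N)); apply/rowP=> j.
rewrite !mxE /= -(eqn_add2l k j) (subnKC le_kd).
by case: eqP => // _; rewrite oppr0.
Qed.

Lemma unit_row_eq (A B : 'M[R]_d.+1) :
  (forall k, (k <= d)%N -> e k *m A = e k *m B) -> A = B.
Proof.
move=> eqAB; apply/row_matrixP=> i.
have := eqAB i (leq_ord i); rewrite !(unit_row_mul _ (ltn_ord i)).
by rewrite (_ : Ordinal _ = i) //; apply: val_inj.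
Qed.

Lemma phi_mx_sqr : ph *m ph = 1%:M.
Proof.
apply: unit_row_eq => k le_kd; rewrite mulmxA unit_row_phi // mulNmx.
by rewrite unit_row_phi ?leq_subr // opprK subKn // mulmx1.
Qed.

Lemma sigma_phi_mx_sqr : sig *m ph *m (sig *m ph) = 1%:M.
Proof.
have step0 : e 0 *m (sig *m ph) = e 0.
  by rewrite mulmxA unit_row_sigma0 mulNmx unit_row_phi // subnn opprK.
have stepS k : (k < d)%N -> e k.+1 *m (sig *m ph) = e 0 - e (d - k).
  move=> lt_kd; rewrite mulmxA unit_row_sigmaS // mulmxBl.
  by rewrite !unit_row_phi ?(ltnW lt_kd) // subnn opprK addrC.
apply: unit_row_eq => -[_|k lt_kd]; first by rewrite mulmxA !step0 mulmx1.
rewrite mulmxA stepS // mulmxBl step0 mulmx1 -(subnSK lt_kd) stepS ?subKn //.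
  by rewrite opprB addrC subrK.
by rewrite ltn_subrL (leq_ltn_trans _ lt_kd).
Qed.

(** The orbit of the last basis row is [e d], then [e (d - k) - e (d.+1 - k)] for
    [0 < k <= d], then [- e 0], after which it closes up.  The rows fixed by
    [sig ^+ d.+2] are stable under [sig], so all the other basis rows follow
    from this one. *)
Lemma sigma_mx_expr : sig ^+ d.+2 = 1.
Proof.
have e_out : e d.+1 = 0 by apply/rowP=> j; rewrite !mxE ltn_eqF.
have last_expr k : (k <= d)%N -> e d *m sig ^+ k = e (d - k) - e (d.+1 - k).
  elim: k => [_|k IHk lt_kd].
    by rewrite expr0 !subn0 mulmx1 e_out subr0.
  rewrite exprSr mulmxA IHk ?(ltnW lt_kd) // mulmxBl -(subnSK lt_kd).
  rewrite unit_row_sigmaS ?ltn_subrL ?(leq_ltn_trans _ lt_kd) //.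
  case: k lt_kd {IHk} => [|k] lt_kd.
    by rewrite subSS !subn0 e_out mul0mx subr0.
  rewrite !subSS -[(d - k)%N](subnSK (ltnW lt_kd)) unit_row_sigmaS.
    by rewrite opprB addrA subrK.
  by rewrite ltn_subrL (leq_ltn_trans _ lt_kd).
have last_fix : e d *m sig ^+ d.+2 = e d.
  suff to_first : e d *m sig ^+ d.+1 = - e 0.
    by rewrite exprSr mulmxA to_first mulNmx unit_row_sigma0 opprK.
  rewrite exprSr mulmxA last_expr // subnn subSnn mulmxBl unit_row_sigma0.
  case: (posnP d) => [d0 | d_gt0]; last first.
    by rewrite unit_row_sigmaS // opprB addrA addNr sub0r.
  have -> : e 1 = e d.+1 by congr (e _.+1).
  by rewrite e_out mul0mx subr0; congr (- e _).
have commr k : sig *m sig ^+ k = sig ^+ k *m sig by rewrite [LHS]commrX.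
(* Downward induction on the row index [d - k], by [e i = e i.+1 *m sig + e d]. *)
suff fix_row k : e (d - k) *m sig ^+ d.+2 = e (d - k).
  apply: unit_row_eq => k le_kd.
  by rewrite -(subKn le_kd) fix_row mulmx1.
elim: k => [|k IHk]; first by rewrite subn0.
have [le_dk | lt_kd] := leqP d k.
  by move: IHk; rewrite (eqP le_dk) (eqP (leqW le_dk)).
have -> : e (d - k.+1) = e (d - k) *m sig + e d.
  rewrite -(subnSK lt_kd) unit_row_sigmaS ?subrK //.
  by rewrite ltn_subrL (leq_ltn_trans _ lt_kd).
by rewrite mulmxDl -mulmxA commr mulmxA IHk last_fix.
Qed.

(** All the coordinates of a fixed row [v] are equal, and its last coordinate is
    minus the sum of the [d.+1] coordinates. *)
Lemma sigma_mx_fix (v : 'rV[R]_d.+1) :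
  v *m sig = v -> v *+ d.+2 = 0.
Proof.
move=> fix_v; have vE j : v 0 j = - \sum_i v 0 i.
  have lastE : v 0 ord_max = - \sum_i v 0 i.
    rewrite -[in LHS]fix_v !mxE -sumrN; apply: eq_bigr => i _.
    by rewrite !mxE eqxx mulrN1.
  suff H k (lt_k : (d - k < d.+1)%N) : v 0 (Ordinal lt_k) = v 0 ord_max.
    have lt_j : (d - (d - j) < d.+1)%N by rewrite ltnS leq_subr.
    rewrite -lastE -(H _ lt_j); congr (v 0 _).
    by apply: val_inj; rewrite /= subKn // -ltnS.
  elim: k lt_k => [|k IHk] lt_k.
    by congr (v 0 _); apply: val_inj; rewrite /= subn0.
  have [le_dk | lt_kd] := leqP d k.
    have lt_k' : (d - k < d.+1)%N by rewrite ltnS leq_subr.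
    rewrite -(IHk lt_k'); congr (v 0 _).
    by apply: val_inj; rewrite /= (eqP le_dk) (eqP (leqW le_dk)).
  have lt_k' : (d - k < d.+1)%N by rewrite ltnS leq_subr.
  rewrite -(IHk lt_k') -[in LHS]fix_v mxE (bigD1 (Ordinal lt_k')) //=.
  rewrite !mxE -val_eqE /= ltn_eqF ?ltn_subrL ?(leq_ltn_trans _ lt_kd) //.
  rewrite subnSK // eqxx mulr1 big1 ?addr0 // => i ne_i.
  rewrite !mxE -val_eqE /= ltn_eqF ?ltn_subrL ?(leq_ltn_trans _ lt_kd) //.
  by rewrite subnSK // [(i == _ :> nat)](negPf ne_i) mulr0.
apply/rowP=> j; rewrite mulmxnE mxE vE.
set S := \sum_i _ in vE *.
have: S = - S *+ d.+1.
  by rewrite [LHS](eq_bigr (fun=> - S)) // sumr_const card_ord.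
by rewrite mulrS => <-; rewrite addNr.
Qed.

End Matrices.

Local Open Scope group_scope.

(** * Graph isomorphisms and cycles *)

Section GraphIso.
Variables (T1 T2 : finType) (Gam1 : graph T1) (Gam2 : graph T2).

Lemma graph_isog_card : graph_isog Gam1 Gam2 -> #|vset Gam1| = #|vset Gam2|.
Proof. by case=> f [injf <- _]; rewrite card_in_imset. Qed.

(** An isomorphism onto a graph on ordinals is best given by its inverse, an
    enumeration of the vertices of the source. *)
Lemma graph_isog_from (h : T2 -> T1) :
    injective h -> 0 < #|T2| -> vset Gam2 = [set: T2] ->
    h @: [set: T2] = vset Gam1 ->
    (forall i j, adj Gam1 (h i) (h j) = adj Gam2 i j) ->
  graph_isog Gam1 Gam2.
Proof.
move=> injh /card_gt0P[i0 _] V2 V1 hadj.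
pose f t := odflt i0 [pick i | h i == t].
have hK : cancel h f.
  move=> i; rewrite /f; case: pickP => [j /eqP/injh // | /(_ i)].
  by rewrite eqxx.
exists f; rewrite -V1 V2; split=> [_ _ /imsetP[i _ ->] /imsetP[j _ ->] | | ].
- by rewrite !hK => ->.
- by rewrite -imset_comp (eq_imset (g := id)) ?imset_id.
by move=> _ _ /imsetP[i _ ->] /imsetP[j _ ->]; rewrite !hK hadj.
Qed.
End GraphIso.

Lemma is_cycle_card (T : finType) (Gam : graph T) :
  is_cycle Gam -> 2 < #|vset Gam|.
Proof. by case=> m m_gt2 /graph_isog_card->; rewrite cardsT card_ord. Qed.

Lemma is_cycle_valency (T : finType) (Gam : graph T) v :
  is_cycle Gam -> v \in vset Gam -> #|[set w in vset Gam | adj Gam v w]| <= 2.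
Proof.
case=> m m_gt2 [f [injf fV fadj]] Vv.
rewrite -(card_in_imset (f := f)) => [|w w']; last first.
  by rewrite !inE => /andP[Vw _] /andP[Vw' _]; apply: injf.
have m_gt0 : 0 < m by apply: ltn_trans m_gt2.
apply: leq_trans (_ : #|[set ordS (f v); ord_pred (f v)]| <= 2); last first.
  by rewrite cards2; case: (_ != _).
apply/subset_leq_card/subsetP=> _ /imsetP[w + ->].
rewrite !inE => /andP[Vw]; rewrite -fadj //= => /orP[/eqP-> | /eqP<-].
  by rewrite eqxx.
by rewrite ordSK eqxx orbT.
Qed.

(** * Coset graphs *)

Lemma actRsE (gT : finGroupType) (A : {set gT}) a : 'Rs%act A a = A :* a.
Proof. by rewrite /= rcosetE. Qed.

Section CosetGraph.
Variables (gT : finGroupType) (G S : {group gT}) (g : gT).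
Hypotheses (sSG : S \subset G) (Gg : g \in G).
Local Notation Gam := (coset_graph G S g).

Lemma rcoset_vertex x : x \in G -> S :* x \in rcosets S G.
Proof. by move=> Gx; rewrite mem_rcosets (subsetP (mulG_subr _ _)). Qed.

(** The double coset of [x * y^-1] does not depend on the representatives [x] and
    [y] of the two right cosets. *)
Lemma adj_coset_graph x y : x \in G -> y \in G ->
  adj Gam (S :* x) (S :* y)
    = (x * y^-1 \in S :* g * S) || (y * x^-1 \in S :* g * S).
Proof.
have swap u v u' v' : S :* u = S :* u' -> S :* v = S :* v' ->
    u * v^-1 \in S :* g * S -> u' * v'^-1 \in S :* g * S.
  move=> /esym/rcoset_eqP/rcosetP[a Sa ->] /esym/rcoset_eqP/rcosetP[b Sb ->].
  case/mulsgP=> c d Sgc Sd def_uv; rewrite invMg !mulgA -(mulgA a) def_uv !mulgA.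
  rewrite -mulgA mem_mulg ?groupM ?groupV //.
  by case/rcosetP: Sgc => c' Sc' ->; rewrite mulgA mem_rcoset mulgK groupM.
move=> Gx Gy; apply/exists_inP/idP => [[x' Gx' /exists_inP[y' Gy']] | xy].
  case/and3P=> /eqP eqx /eqP eqy /orP[] /swap h; apply/orP; [left|right];
  exact: h.
by exists x => //; apply/exists_inP; exists y; rewrite // !eqxx.
Qed.

Lemma adj_coset_graph_mul a A B :
    a \in G -> A \in rcosets S G -> B \in rcosets S G ->
  adj Gam (A :* a) (B :* a) = adj Gam A B.
Proof.
move=> Ga /rcosetsP[x Gx ->] /rcosetsP[y Gy ->].
by rewrite -!rcosetM !adj_coset_graph ?groupM // !invMg !mulgA !mulgK.
Qed.

Lemma adj_coset_graphP A B : adj Gam A B ->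
  exists x y, [/\ x \in G, y \in G, A = S :* x & B = S :* y].
Proof.
case/exists_inP=> x Gx /exists_inP[y Gy /and3P[/eqP-> /eqP-> _]].
by exists x, y.
Qed.

Lemma adj_coset_graph_sym : symmetric (adj Gam).
Proof.
by move=> A B; apply/idP/idP => AB;
  have [x [y [Gx Gy defA defB]]] := adj_coset_graphP AB;
  move: AB; rewrite defA defB !adj_coset_graph // orbC.
Qed.

Lemma coset_graph_simple : g \notin S -> simple_graph Gam.
Proof.
move=> S'g; split=> [A B | A B | A].
- case/adj_coset_graphP=> x [y [Gx Gy -> ->]] /=.
  by rewrite !rcoset_vertex.
- exact: adj_coset_graph_sym.
apply: contraNF S'g => AA; have [x [y [Gx _ defA _]]] := adj_coset_graphP AA.
move: AA; rewrite defA adj_coset_graph // mulgV orbb => /mulsgP[c b].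
case/rcosetP=> a Sa -> Sb /esym/eqP; rewrite -eq_invg_mul => /eqP ag.
by rewrite -(groupMl _ Sa) -[_ * _]invgK ag groupV.
Qed.

Lemma adj_coset_graph_base : adj Gam S (S :* g).
Proof.
by rewrite -[X in adj _ X]mulg1 adj_coset_graph // invg1 mulg1 orbC
  -{1}[g]mulg1 mem_mulg // rcoset_refl.
Qed.

(** Right multiplication preserves adjacency, so the [a] in [G] such that [S :* a]
    is connected to [S] form a subgroup; it contains [S] and [g]. *)
Lemma coset_graph_connected : <<g |: S>> = G -> connected_graph Gam.
Proof.
move=> genG; pose e := adj Gam; pose K := [set a in G | connect e S (S :* a)].
have shift a A B : a \in G -> connect e A B -> connect e (A :* a) (B :* a).
  move=> Ga /connectP[q e_q ->] {B}; elim: q A e_q => //= B q IHq A /andP[AB e_q].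
  apply: connect_trans (IHq _ e_q); apply: connect1.
  have [x [y [Gx Gy defA defB]]] := adj_coset_graphP AB.
  by rewrite /e adj_coset_graph_mul // ?defA ?defB rcoset_vertex.
have gK : group_set K.
  apply/group_setP; rewrite !inE group1 mulg1 connect0; split=> // a b.
  rewrite !inE => /andP[Ga Sa] /andP[Gb Sb]; rewrite groupM //=.
  by apply: connect_trans Sb _; rewrite rcosetM; apply: shift.
have sGK : G \subset K.
  rewrite -genG -[K]/(gval (Group gK)) gen_subG subUset sub1set inE Gg /=.
  apply/andP; split; first exact/connect1/adj_coset_graph_base.
  apply/subsetP=> a Sa.
  by rewrite inE (subsetP sSG) //= rcoset_id.
move=> _ _ /rcosetsP[x Gx ->] /rcosetsP[y Gy ->].
have := subsetP sGK y Gy; have := subsetP sGK x Gx.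
rewrite !inE Gx Gy /= (sym_connect_sym adj_coset_graph_sym).
exact: connect_trans.
Qed.

(** The stabilisers of the vertices [S] and [S :* g] are [S] and [S :^ g]. *)
Lemma coset_graph_faithful :
  S :&: S :^ g = 1 -> [faithful G, on vset Gam | 'Rs].
Proof.
move=> tiSg; rewrite /faithful -tiSg; apply/subsetP=> a /setIP[_ /astabP fix_a].
rewrite inE mem_conjg.
have fixa x : x \in G -> a ^ x^-1 \in S.
  move=> Gx; have := fix_a _ (rcoset_vertex Gx).
  by rewrite /= rcosetE -rcosetM => /rcoset_eqP;
    rewrite mem_rcoset conjgE invgK mulgA.
by rewrite fixa // andbT -[a]conjg1 -invg1 fixa.
Qed.

Lemma coset_graph_acts : S :&: S :^ g = 1 -> acts_as_automorphisms Gam G 'Rs.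
Proof.
move=> tiSg; split; first exact/atrans_acts/transRs_rcosets.
  exact: coset_graph_faithful.
by move=> a Ga A B VA VB; rewrite !actRsE adj_coset_graph_mul.
Qed.

(** If [x * y^-1 = c * g * b] with [b] and [c] in [S], then [b * y] maps the base
    edge [{S, S :* g}] to [{S :* y, S :* x}]. *)
Lemma coset_graph_edge_transitive : [transitive G, on edges Gam | 'Rs^*].
Proof.
have act2 (A B : {set gT}) a : 'Rs^*%act [set A; B] a = [set A :* a; B :* a].
  by rewrite /= /setact imsetU !imset_set1 /= !rcosetE.
apply/imsetP; exists [set gval S; S :* g].
  apply/imsetP; exists (gval S, S :* g); rewrite // inE.
  exact: adj_coset_graph_base.
apply/setP=> E; apply/imsetP/imsetP => [[[A B] + ->] | [a Ga ->]].
  rewrite inE => AB; have {}AB : adj Gam A B := AB.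
  have [x [y [Gx Gy defA defB]]] := adj_coset_graphP AB.
  have half u v : u \in G -> v \in G -> u * v^-1 \in S :* g * S ->
      exists2 a, a \in G & (S :* a = S :* v) /\ (S :* g :* a = S :* u).
    move=> Gu Gv /mulsgP[d b /rcosetP[c Sc ->] Sb def_uv].
    exists (b * v); first by rewrite groupM // (subsetP sSG).
    split; first by rewrite rcosetM rcoset_id.
    by rewrite -rcosetM -[u](mulgKV v) def_uv -!mulgA (rcosetM S c) (rcoset_id Sc).
  move: AB; rewrite defA defB adj_coset_graph // => /orP[] /half[] // a Ga [Sa Sga].
    by exists a; rewrite // act2 Sa Sga setUC.
  by exists a; rewrite // act2 Sa Sga.
exists (S :* a, S :* g :* a); last by rewrite act2.
rewrite inE; have -> : S :* a = S :* 1 :* a by rewrite mulg1.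
apply: etrans (adj_coset_graph_mul Ga _ _) _; rewrite ?rcoset_vertex //.
by rewrite mulg1; apply: adj_coset_graph_base.
Qed.

(** Arc-transitivity would give an element that exchanges [S] and [S :* g]; it is
    of the form [c * g] with [c] and [g * (c * g)] in [S], so that [g^-1] is in
    [S :* g * S]. *)
Lemma coset_graph_oriented : g^-1 \notin S :* g * S -> oriented Gam G 'Rs.
Proof.
move=> asym; split; [exact: transRs_rcosets|exact: coset_graph_edge_transitive|].
move=> arcG; have base_sym : adj Gam (S :* g) S.
  by rewrite adj_coset_graph_sym adj_coset_graph_base.
have [a Ga []] := arcG _ _ _ _ adj_coset_graph_base base_sym.
rewrite /= !rcosetE => /rcoset_eqP/rcosetP[c Sc def_a].
rewrite -rcosetM def_a -[RHS]mulg1 => /rcoset_eqP.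
rewrite mem_rcoset invg1 mulg1 => Sb.
case/negP: asym; have -> : g^-1 = c * g * (g * (c * g))^-1.
  by rewrite !invMg !mulgA !mulgK mulgV mul1g.
by rewrite mem_mulg ?groupV // mem_rcoset mulgK.
Qed.

End CosetGraph.

(** * Normal quotients of coset graphs *)

Section NormalQuotients.
Variables (gT : finGroupType) (G S : {group gT}) (g : gT).
Hypotheses (sSG : S \subset G) (Gg : g \in G).
Local Notation Gam := (coset_graph G S g).
Local Notation orb M x := (orbit 'Rs M (S :* x)).

Section OneSubgroup.
Variable M : {group gT}.
Hypothesis nsMG : M <| G.

(** As [M] is normal, [S :* (x * m)] ranges over the cosets of [S] contained in
    [S * M :* x] when [m] ranges over [M]. *)
Lemma mem_orbit_rcoset x y : x \in G ->
  (S :* y \in orb M x) = (y * x^-1 \in S * M).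
Proof.
move=> Gx; have nMx m : m \in M -> m ^ x^-1 \in M.
  by move=> Mm; rewrite memJ_norm // groupV (subsetP (normal_norm nsMG)).
apply/orbitP/mulsgP => [[m Mm] | [a m Sa Mm def_y]].
  rewrite actRsE -rcosetM => /esym/rcoset_eqP/rcosetP[a Sa ->].
  exists a (m ^ x^-1) => //; first exact: nMx.
  by rewrite conjgE invgK !mulgA.
exists (m ^ x); first by rewrite memJ_norm // (subsetP (normal_norm nsMG)).
rewrite actRsE -rcosetM -conjgC -[y](mulgKV x) def_y -mulgA.
by rewrite (rcosetM S a) (rcoset_id Sa).
Qed.

Lemma orbit_rcosetP x A : x \in G ->
  reflect (exists2 y, y \in G & A = S :* y /\ y * x^-1 \in S * M) (A \in orb M x).
Proof.
move=> Gx; apply: (iffP idP) => [xA | [y _ [-> Ly]]]; last first.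
  by rewrite mem_orbit_rcoset.
have /orbitP[m Mm defA] := xA; exists (x * m).
  by rewrite groupM // (subsetP (normal_sub nsMG)).
have {}defA : A = S :* (x * m) by rewrite -defA actRsE rcosetM.
by split; rewrite // -mem_orbit_rcoset // -defA.
Qed.

Lemma orbit_rcoset_eq x y : x \in G ->
  (orb M y == orb M x) = (y * x^-1 \in S * M).
Proof.
move=> Gx; rewrite -mem_orbit_rcoset //.
by apply/eqP/idP => [<- | /orbit_eqP//]; apply: orbit_refl.
Qed.

Lemma vset_normal_quotientP O :
  reflect (exists2 x, x \in G & O = orb M x)
          (O \in vset (normal_quotient Gam 'Rs M)).
Proof.
apply: (iffP imsetP) => [[_ /rcosetsP[x Gx ->] ->] | [x Gx ->]]; first by exists x.
by exists (S :* x); rewrite // rcoset_vertex.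
Qed.

(** [M] acts on the graph, so that any edge between two orbits can be moved to one
    starting from the representative of the first orbit. *)
Lemma adj_normal_quotient x y : x \in G -> y \in G ->
  adj (normal_quotient Gam 'Rs M) (orb M x) (orb M y)
    = (orb M x != orb M y) && [exists B in orb M y, adj Gam (S :* x) B].
Proof.
move=> Gx Gy; have V z : z \in G -> orb M z \in orbit 'Rs M @: vset Gam.
  by move=> Gz; apply/vset_normal_quotientP; exists z.
(* The definition is restated to keep [adj Gam] folded. *)
transitivity [&& orb M x \in orbit 'Rs M @: vset Gam,
    orb M y \in orbit 'Rs M @: vset Gam, orb M x != orb M y
  & [exists A in orb M x, exists B in orb M y, adj Gam A B]]; first by [].
rewrite !V // !andTb; congr (_ && _); apply/exists_inP/exists_inP.
  case=> A /orbitP[m Mm <-] /exists_inP[B yB]; rewrite actRsE => xmB.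
  have Gm := subsetP (normal_sub nsMG) m Mm.
  exists (B :* m^-1).
    have /orbitP[m' Mm' <-] := yB; rewrite actRsE -[_ :* m^-1]rcosetM -actRsE.
    by rewrite mem_orbit // groupM ?groupV.
  have Vxm : S :* x :* m \in rcosets S G by rewrite -rcosetM rcoset_vertex ?groupM.
  have VB : B \in rcosets S G.
    by have /(orbit_rcosetP _ Gy)[z Gz [-> _]] := yB; apply: rcoset_vertex.
  move: xmB; rewrite -(adj_coset_graph_mul g (groupVr Gm) Vxm VB).
  by rewrite -!rcosetM mulgV mulg1.
case=> B yB xB; exists (S :* x); first exact: orbit_refl.
by apply/exists_inP; exists B.
Qed.

(** [a] maps the orbit of [S :* x] to that of [S :* (x * a)], so the kernel is the
    core of [S * M] in [G]. *)
Lemma mem_quotient_kernel a :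
  (a \in quotient_kernel Gam G 'Rs M)
    = (a \in G) && [forall x in G, x * a * x^-1 \in S * M].
Proof.
rewrite inE; case Ga: (a \in G) => //=.
have actO x : x \in G -> 'Rs^*%act (orb M x) a = orb M (x * a).
  move=> Gx; have nMa := subsetP (normal_norm nsMG) a Ga.
  apply/setP=> B; apply/imsetP/orbitP => [[_ /orbitP[m Mm <-] ->] | [m Mm <-]].
    exists (m ^ a); first by rewrite memJ_norm.
    by rewrite !actRsE -!rcosetM -!mulgA -conjgC.
  exists ('Rs%act (S :* x) (m ^ a^-1)).
    by rewrite mem_orbit // memJ_norm ?groupV.
  by rewrite !actRsE -!rcosetM conjgE invgK !mulgA mulgKV.
apply/astabP/forall_inP => [fix_a x Gx | fix_a _ /vset_normal_quotientP[x Gx ->]].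
  rewrite -orbit_rcoset_eq // -actO // fix_a //.
  by apply/vset_normal_quotientP; exists x.
by rewrite actO //; apply/eqP; rewrite orbit_rcoset_eq ?fix_a.
Qed.

Lemma normal_quotient_full : S * M = G ->
  graph_isog (normal_quotient Gam 'Rs M) (complete_graph 1).
Proof.
move=> defG; have orb1 x : x \in G -> orb M x = orb M 1.
  by move=> Gx; apply/eqP; rewrite orbit_rcoset_eq // defG invg1 mulg1.
apply: (@graph_isog_from _ _ _ _ (fun=> orb M 1)) => //.
- by move=> i j _; rewrite !ord1.
- by rewrite card_ord.
- apply/setP=> O; apply/imsetP/vset_normal_quotientP => [[_ _ ->] | [x Gx ->]].
    by exists 1.
  by exists ord0; rewrite ?orb1.
by move=> i j; rewrite adj_normal_quotient // eqxx /= !ord1.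
Qed.
End OneSubgroup.

Lemma eq_normal_quotient (M K : {group gT}) :
    M <| G -> K <| G -> S * M = S * K ->
  normal_quotient Gam 'Rs M = normal_quotient Gam 'Rs K.
Proof.
move=> nsMG nsKG eqMK; rewrite /normal_quotient.
suff -> : orbit 'Rs M @: vset Gam = orbit 'Rs K @: vset Gam by [].
apply: eq_in_imset => _ /rcosetsP[x Gx ->]; apply/setP=> B.
by apply/(orbit_rcosetP nsMG _ Gx)/(orbit_rcosetP nsKG _ Gx); rewrite eqMK.
Qed.

End NormalQuotients.

(** * Dihedral groups *)

Section Dihedral.
Variables (gT : finGroupType) (x s : gT).
Hypotheses (odd_x : odd #[x]) (x_neq1 : x != 1).
Hypotheses (os : #[s] = 2) (xs : x ^ s = x^-1).

Lemma odd_dihedral_mul : <<[set x; s]>> = <[x]> * <[s]>.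
Proof.
rewrite -norm_joinEr ?joing_idl ?joing_idr //.
by rewrite norms_cycle xs groupV cycle_id.
Qed.

Lemma odd_dihedral_card : #|<<[set x; s]>>| = #[x].*2.
Proof.
rewrite odd_dihedral_mul coprime_cardMg -/(#[x]) -/(#[s]) os ?muln2 //.
by rewrite coprimen2.
Qed.

Lemma odd_dihedral_isog : <<[set x; s]>> \isog [set: 'D_(#[x].*2)].
Proof.
have x_gt1 : 1 < #[x] by rewrite order_gt1.
rewrite isogEcard odd_dihedral_card card_dihedral // leqnn andbT.
rewrite Grp_dihedral //; apply/existsP; exists (x, s) => /=.
by rewrite !xpair_eqE joing_idl joing_idr eqxx expg_order -os expg_order xs !eqxx.
Qed.
End Dihedral.

(** * Extensions of an irreducible abelian group by a dihedral group *)

Section DihedralExtension.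
Variables (gT : finGroupType) (G N : {group gT}) (n x s : gT).
Local Notation r := #[x].
Local Notation S := <[s]>%G.
Local Notation g := (n * x).
Local Notation Gam := (coset_graph G S g).
Local Notation orb M y := (orbit 'Rs M (S :* y)).
Hypotheses (defG : N ><| <<[set x; s]>> = G).
Hypotheses (r_prime : prime r) (r_odd : odd r).
Hypotheses (os : #[s] = 2) (xs : x ^ s = x^-1).
Hypotheses (cNN : abelian N) (Nn : n \in N).
Hypotheses (ns : n ^ s = n ^ x) (n2 : n * n != 1).
Hypothesis faithN : 'C_(<<[set x; s]>>)(N) = 1.
Hypothesis irrN : forall M : {group gT},
  M \subset N -> x \in 'N(M) -> M :=: 1 \/ M :=: N.

Let nsNG : N <| G. Proof. by have [] := sdprod_context defG. Qed.
Let sHG : <<[set x; s]>> \subset G. Proof. by have [] := sdprod_context defG. Qed.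
Let Gx : x \in G. Proof. by rewrite (subsetP sHG) // mem_gen // !inE eqxx. Qed.
Let Gs : s \in G. Proof. by rewrite (subsetP sHG) // mem_gen // !inE eqxx orbT. Qed.
Let sNG : N \subset G. Proof. exact: normal_sub nsNG. Qed.
Let Gn : n \in G. Proof. exact: subsetP sNG n Nn. Qed.
Let Gg : g \in G. Proof. exact: groupM. Qed.
Let sSG : S \subset G. Proof. by rewrite cycle_subG. Qed.
Let x_neq1 : x != 1. Proof. by rewrite -order_gt1 prime_gt1. Qed.
Let memNJ m y : m \in N -> y \in G -> m ^ y \in N.
Proof. by move=> Nm Gy; rewrite memJ_norm // (subsetP (normal_norm nsNG)). Qed.

Let r_gt2 : 2 < r. Proof. exact: odd_prime_gt2. Qed.
Let x2_neq1 : x ^+ 2 != 1.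
Proof. by rewrite -order_dvdn gtnNdvd. Qed.

(* The stabiliser of the [N]-orbit of the base vertex [S]. *)
Let L := (S <*> N)%G.
Let LE : S * N = L.
Proof. by rewrite /= norm_joinEl // (subset_trans sSG) ?normal_norm. Qed.
Let sSL : S \subset L. Proof. exact: joing_subl. Qed.
Let sNL : N \subset L. Proof. exact: joing_subr. Qed.

(* [<[x]>] meets [L = S N] trivially: [S N] meets the complement [<<[set x; s]>>]
   of [N] in [S], and [S] and [<[x]>] have coprime orders. *)
Let L_cycle y : y \in <[x]> -> (y \in L) = (y == 1).
Proof.
move=> xy; apply/idP/eqP => [|->]; last exact: group1.
rewrite -LE => /mulsgP[a m Sa Nm def_y].
have [_ _ _ _ tiNH] := sdprod_context defG.
have m1 : m = 1.
  apply/set1gP; rewrite -tiNH inE Nm /= -[m](mulKg a) -def_y groupM ?groupV //.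
    by rewrite (subsetP _ a Sa) // cycle_subG mem_gen // !inE eqxx orbT.
  by rewrite (subsetP _ y xy) // cycle_subG mem_gen // !inE eqxx.
have ti : <[x]> :&: S = 1 by rewrite coprime_TIg // -/(#[x]) -/(#[s]) os coprimen2.
by apply/set1gP; rewrite -ti inE xy def_y m1 mulg1.
Qed.

(* [L] is a union of cosets of the normal subgroup [N], so factors from [N] can
   be dropped anywhere in a product when its membership in [L] is tested. *)
Let LNr y m z : m \in N -> z \in G -> (y * m * z \in L) = (y * z \in L).
Proof.
move=> Nm Gz; rewrite -mulgA (conjgC m) mulgA groupMr //.
by rewrite (subsetP sNL) // memNJ.
Qed.
Let LNl m z : m \in N -> z \in G -> (m * z \in L) = (z \in L).
Proof. by move=> Nm Gz; rewrite -[m]mul1g LNr // mul1g. Qed.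

Let gs : g ^ s = x^-1 * n.
Proof. by rewrite conjMg ns xs conjgE !mulgA mulgK. Qed.

Let in_S b : b \in S -> b = 1 \/ b = s.
Proof. by rewrite /= cycle2g // !inE => /orP[] /eqP; [left | right]. Qed.

(* [S] has order 2, so [S h S] is the union of [S h] and [S h s = S (h ^ s)]. *)
Let mem_double_coset h z :
  (z \in S :* h * S) = (S :* z == S :* h) || (S :* z == S :* (h ^ s)).
Proof.
have Ss : s \in S by apply: cycle_id.
apply/idP/orP => [/mulsgP[c b /rcosetP[a Sa ->] Sb ->] | ].
  case: (in_S Sb) => ->.
    by left; rewrite mulg1 (rcosetM S a) (rcoset_id Sa).
  right; rewrite -mulgA (conjgC h) (rcosetM S a) (rcoset_id Sa).
  by rewrite (rcosetM S s) (rcoset_id Ss).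
case=> /eqP/rcoset_eqP/rcosetP[a Sa ->].
  by rewrite -[a * h]mulg1 mem_mulg // mem_rcoset mulgK.
by rewrite conjgE !mulgA mem_mulg // mem_rcoset mulgK groupM ?groupV.
Qed.

Let dcV u h : u \in S :* h * S -> u^-1 \in S :* h^-1 * S.
Proof.
case/mulsgP=> c b /rcosetP[a Sa ->] Sb ->.
by rewrite !invMg mulgA mem_mulg ?groupV // mem_rcoset mulgK groupV.
Qed.

Let nbrs y : seq {set gT} :=
  [:: S :* (n * x * y); S :* (n^-1 * x * y);
      S :* (x^-1 * n * y); S :* (x^-1 * n^-1 * y)].

(** The four entries of [nbrs y] are [S h y] for [h] in [g], [g ^ s], [g^-1] and
    [(g ^ s)^-1], up to order. *)
Lemma adj_nbrs y B : y \in G -> adj Gam (S :* y) B = (B \in nbrs y).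
Proof.
move=> Gy.
have shift h z : (S :* (z * y^-1) == S :* h) = (S :* z == S :* (h * y)).
  apply/eqP/eqP => [e | e].
    by rewrite (rcosetM S h) -e -rcosetM mulgKV.
  by rewrite rcosetM e -rcosetM mulgK.
have adjE z : z \in G -> adj Gam (S :* y) (S :* z) = (S :* z \in nbrs y).
  move=> Gz; rewrite adj_coset_graph // orbC mem_double_coset gs.
  have -> : (y * z^-1 \in S :* g * S) = (z * y^-1 \in S :* g^-1 * S).
    by apply/idP/idP => /dcV; rewrite invMg ?invgK.
  rewrite mem_double_coset conjVg gs !invMg invgK !shift !inE.
  by do !case: (_ == _).
apply/idP/idP => [yB | ].
  have [y' [z [_ Gz _ defB]]] := adj_coset_graphP yB.
  by move: yB; rewrite defB adjE.
have [Gn' Gx'] := (groupVr Gn, groupVr Gx).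
by rewrite !inE => /or4P[] /eqP->; rewrite adjE ?groupM // !inE eqxx ?orbT.
Qed.

(* Already the [N]-orbits differ: the quotient of [m * x] by [x^-1 * m'] is
   [x ^+ 2] modulo [N]. *)
Let nbr_apart m m' y : m \in N -> m' \in N ->
  (S :* (m * x * y) == S :* (x^-1 * m' * y)) = false.
Proof.
move=> Nm Nm'; apply/eqP=> /rcoset_eqP.
rewrite mem_rcoset !invMg invgK !mulgA mulgK.
have [Gm Gm'] := (subsetP sNG m Nm, subsetP sNG m' Nm').
move/(subsetP sSL); rewrite -!mulgA (LNl Nm (groupM Gx (groupM (groupVr Gm') Gx))).
rewrite mulgA (LNr _ (groupVr Nm') Gx).
by rewrite -expg2 L_cycle ?mem_cycle // (negPf x2_neq1).
Qed.

Let tiSN u : u \in S -> u \in N -> u = 1.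
Proof.
move=> Su Nu; have [_ _ _ _ tiNH] := sdprod_context defG.
apply/set1gP; rewrite -tiNH inE Nu (subsetP _ u Su) // cycle_subG mem_gen //.
by rewrite !inE eqxx orbT.
Qed.

Let nbr_inv m y : m \in N -> m * m != 1 ->
  ((S :* (m * x * y) == S :* (m^-1 * x * y)) = false)
  * ((S :* (x^-1 * m * y) == S :* (x^-1 * m^-1 * y)) = false).
Proof.
move=> Nm m2; have Gm := subsetP sNG m Nm.
split; apply/eqP=> /rcoset_eqP; rewrite mem_rcoset !invMg !invgK !mulgA mulgK.
  by rewrite mulgK => /tiSN; rewrite groupM // => /(_ isT)/eqP; apply/negP.
have -> : x^-1 * m * m * x = (m * m) ^ x by rewrite conjgE !mulgA.
move=> /tiSN; rewrite memNJ ?groupM // => /(_ isT)/eqP.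
by rewrite conjg_eq1; apply/negP.
Qed.

Let nbrs_uniq y : uniq (nbrs y).
Proof. by rewrite /= !inE !nbr_apart ?groupV // !nbr_inv. Qed.

Let gV_notin : g^-1 \notin S :* g * S.
Proof.
rewrite mem_double_coset gs invMg negb_or.
have := nbrs_uniq 1; rewrite /= !mulg1 !inE !negb_or.
case/and4P=> /and3P[_ _ ne1] _ ne2 _; rewrite eq_sym ne1 eq_sym.
by rewrite ne2.
Qed.

Let g_notin_L : g \notin L.
Proof. by rewrite LNl // L_cycle ?cycle_id. Qed.

Lemma OG4_coset_graph : OG4 Gam G 'Rs.
Proof.
split.
- by apply: coset_graph_simple; apply: contra g_notin_L; apply: subsetP.
- apply: coset_graph_connected => //; apply/eqP.
  rewrite eqEsubset gen_subG subUset sub1set Gg sSG /=.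
  set K := <<_>>; have Ks : s \in K by rewrite mem_gen // !inE cycle_id orbT.
  have Kg : g \in K by rewrite mem_gen // !inE eqxx.
  (* [n] normalises [K :&: N] because [N] is abelian, hence so does [x]. *)
  have nKN : x \in 'N(K :&: N).
    have nKNg : g \in 'N(K :&: N).
      rewrite (subsetP (normsI (normG _) _) g Kg) //.
      rewrite (subset_trans _ (normal_norm nsNG)) //.
      by rewrite gen_subG subUset sub1set Gg sSG.
    have nKNn : n \in 'N(K :&: N).
      by rewrite (subsetP _ n Nn) // sub_abelian_norm // subsetIr.
    by rewrite -(groupMl _ nKNn).
  have Kn2 : n * n \in K :&: N.
    rewrite inE (groupM Nn) // andbT; have -> : n * n = g * g ^ s.
      by rewrite gs mulgA mulgK.
    by rewrite groupM // groupJ.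
  have sNK : N \subset K.
    have [KN1 | <-] := irrN (subsetIr K N) nKN; last exact: subsetIl.
    by case/eqP: n2; apply/set1gP; rewrite -KN1.
  have Kx : x \in K by rewrite -(groupMl _ (subsetP sNK n Nn)).
  have [_ <- _ _] := sdprodP defG.
  by rewrite mul_subG // gen_subG subUset !sub1set Kx.
- move=> _ /rcosetsP[y Gy ->].
  rewrite cardsE (eq_card (B := mem (nbrs y))) => [|B]; last first.
    exact: adj_nbrs.
  by rewrite (card_uniqP _).
- apply: coset_graph_acts => //; apply/trivgP/subsetP=> u.
  rewrite inE mem_conjg => /andP[/in_S[-> | ->]]; first by rewrite set11.
  case/in_S=> [/eqP | sg]; first by rewrite conjg_eq1 => /eqP->; rewrite set11.
  have gsg : g ^ s = g.
    apply/conjg_fixP/commgP.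
    by rewrite /commute -[in RHS]sg conjgE invgK (mulgA g) mulgKV.
  have := nbr_apart 1 Nn Nn; rewrite !mulg1 => /eqP[].
  by rewrite -gs gsg.
exact: coset_graph_oriented.
Qed.

(* The quotient by the trivial group is a copy of [Gam], in which [S] has four
   neighbours. *)
Let orb1_not_cycle (M : {group gT}) :
  M :=: 1 -> ~ is_cycle (normal_quotient Gam 'Rs M).
Proof.
move=> M1; have nsMG : M <| G by rewrite M1 normal1.
have SM : S * M = S by rewrite M1 mulg1.
have [_ _ val4 _ _] := OG4_coset_graph.
move/is_cycle_valency=> /(_ (orb M 1)) val2.
have /val2 : orb M 1 \in vset (normal_quotient Gam 'Rs M).
  by apply/vset_normal_quotientP; exists 1.
apply/negP; rewrite -ltnNge.
have S1 : gval S \in vset Gam by rewrite /= -[X in X \in _]mulg1 rcoset_vertex.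
apply: (@leq_trans #|[set B | adj Gam S B]|); first by rewrite (val4 _ S1).
have vertexP B : adj Gam S B -> exists2 y, y \in G & B = S :* y.
  by case/adj_coset_graphP=> y [z [_ Gz _ ->]]; exists z.
rewrite -(card_in_imset (f := orbit 'Rs M)).
  apply/subset_leq_card/subsetP=> _ /imsetP[B + ->].
  rewrite inE => SB; have [y Gy defB] := vertexP _ SB.
  rewrite inE; apply/andP; split.
    by apply/vset_normal_quotientP; exists y; rewrite ?defB.
  have O1 : orbit 'Rs M S = orb M 1 by rewrite mulg1.
  rewrite defB ?O1 (adj_normal_quotient S g nsMG) //.
  rewrite (orbit_rcoset_eq S nsMG) // SM mul1g groupV; apply/andP; split; last first.
    by apply/exists_inP; exists (S :* y); rewrite ?orbit_refl // mulg1 -defB.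
  apply: contraTN SB => Sy; rewrite defB rcoset_id //.
  have [_ _ irr] := coset_graph_simple G (contra (subsetP sSL g) g_notin_L).
  by rewrite irr.
move=> A B; rewrite !inE => /vertexP[y Gy ->] /vertexP[z Gz ->] /eqP.
by rewrite (orbit_rcoset_eq S nsMG) // SM -mem_rcoset => /rcoset_eqP.
Qed.

(* Otherwise [M :&: N = 1] by irreducibility, so that [M] centralises [N]; but
   [N] is its own centraliser, whence [M \subset N] and [M = 1]. *)
Let sub_normal (M : {group gT}) : M <| G -> M :!=: 1 -> N \subset M.
Proof.
move=> nsMG ntM; have /andP[sMG nMG] := nsMG.
have nMNx : x \in 'N(M :&: N).
  by rewrite (subsetP (normsI nMG (normal_norm nsNG))).
have [MN1 | <-] := irrN (subsetIr M N) nMNx; last exact: subsetIl.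
case/eqP: ntM; apply/trivgP/subsetP=> a Ma.
have cMN : M \subset 'C(N).
  apply/commG1P/trivgP; rewrite -MN1 subsetI commg_subl commg_subr.
  by rewrite (subset_trans sNG) // (subset_trans sMG) // normal_norm.
have [_ defNH _ _] := sdprodP defG.
have := subsetP sMG a Ma; rewrite -defNH => /mulsgP[z h Nz Hh def_a].
have h1 : h = 1.
  apply/set1gP; rewrite -faithN inE Hh /= -[h](mulKg z) -def_a groupM ?groupV //.
    by rewrite (subsetP cNN).
  by rewrite (subsetP cMN).
by rewrite -MN1 inE Ma def_a h1 mulg1.
Qed.

Let index_L : #|G : L| = r.
Proof.
have H2 : #|<<[set x; s]>>| = r.*2 by apply: odd_dihedral_card.
have cL : #|L| = (2 * #|N|)%N.
  rewrite -LE TI_cardMg; first by rewrite -os.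
  by apply/trivgP/subsetP=> u /setIP[/tiSN/[apply]->]; apply: set11.
apply/eqP; rewrite -(eqn_pmul2l (cardG_gt0 L)) Lagrange; last first.
  by rewrite join_subG sSG.
by rewrite -(sdprod_card defG) H2 cL -muln2 (mulnC 2) -mulnA (mulnC 2).
Qed.

(* [S N] has prime index in [G], and [S M] lies between the two. *)
Let mul_S_normal (M : {group gT}) : M <| G -> M :!=: 1 ->
  S * M = G \/ S * M = S * N.
Proof.
move=> nsMG ntM; have sNM := sub_normal nsMG ntM; have /andP[sMG nMG] := nsMG.
have SME : S * M = S <*> M by rewrite norm_joinEl // (subset_trans sSG).
have sLM : L \subset S <*> M by rewrite genS // setUS.
have sMG' : S <*> M \subset G by rewrite join_subG sSG.
have := Lagrange_index sMG' sLM; rewrite index_L => eq_r.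
have /primeP[_ /(_ #|G : S <*> M|)] := r_prime.
rewrite -[X in _ %| X]eq_r dvdn_mulr // SME LE => /(_ isT)/orP[iG1 | /eqP iGr].
  by left; apply/eqP; rewrite eqEsubset sMG' -indexg_eq1.
right; apply/eqP; rewrite eqEsubset sLM andbT -indexg_eq1.
by rewrite -(eqn_pmul2l (prime_gt0 r_prime)) muln1 -{1}iGr eq_r.
Qed.

Let x_expr_eqL i j : x ^+ i * (x ^+ j)^-1 \in L = (x ^+ i == x ^+ j).
Proof. by rewrite L_cycle ?groupM ?groupV ?mem_cycle // -eq_mulgV1. Qed.

(** The vertices are the orbits of the cosets [S x ^+ i], since [G = S N <x>].
    Modulo [N], the list of neighbours of [S x ^+ i] reduces to [S x ^+ i.+1] and
    [S x^-1 x ^+ i]. *)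
Lemma normal_quotient_N : graph_isog (normal_quotient Gam 'Rs N) (cycle_graph r).
Proof.
have Gxi i : x ^+ i \in G by apply: groupX.
apply: (@graph_isog_from _ _ _ _ (fun i : 'I_r => orb N (x ^+ i))).
- move=> i j /eqP; rewrite (orbit_rcoset_eq S nsNG) // LE x_expr_eqL.
  by rewrite eq_expg_mod_order !modn_small // => /eqP/val_inj.
- by rewrite card_ord prime_gt0.
- by [].
- apply/setP=> O; apply/imsetP/vset_normal_quotientP => [[i _ ->] | [y Gy ->]].
    by exists (x ^+ i).
  have [_ defNH _ _] := sdprodP defG.
  have := groupVr Gy; rewrite -{1}defNH odd_dihedral_mul //.
  case/mulsgP=> z h Nz /mulsgP[u b xu Sb ->] def_y.
  have /cyclePmin[i lt_ir def_u] : u^-1 \in <[x]> by rewrite groupV.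
  exists (Ordinal lt_ir) => //=; apply/eqP.
  rewrite (orbit_rcoset_eq S nsNG) // -def_u -[y]invgK def_y !invMg invgK LE.
  rewrite -!mulgA (groupMl _ (groupVr (subsetP sSL b Sb))) -conjgE.
  have Gu : u \in G by rewrite -[u]invgK groupV def_u.
  by rewrite (subsetP sNL) // memNJ ?groupV.
move=> i j; rewrite (adj_normal_quotient S g nsNG) //.
have nbr_orb h :
    S :* (h * x ^+ i) \in orb N (x ^+ j) = (h * (x ^+ i * (x ^+ j)^-1) \in L).
  by rewrite (mem_orbit_rcoset S nsNG) ?LE // mulgA.
have Gij : x ^+ i * (x ^+ j)^-1 \in G by rewrite groupM ?groupV.
have nbr_next m : m \in N ->
    (S :* (m * x * x ^+ i) \in orb N (x ^+ j)) = (x ^+ i.+1 == x ^+ j).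
  move=> Nm; rewrite nbr_orb -mulgA LNl ?(groupM Gx) // mulgA -expgS.
  exact: x_expr_eqL.
have nbr_prev m : m \in N ->
    (S :* (x^-1 * m * x ^+ i) \in orb N (x ^+ j)) = (x ^+ j.+1 == x ^+ i).
  move=> Nm; rewrite nbr_orb LNr // L_cycle ?groupM ?groupV ?mem_cycle ?cycle_id //.
  rewrite -eq_mulVg1 expgS; apply/eqP/eqP => [{1}-> | <-]; first by rewrite mulgKV.
  by rewrite mulgK.
have nbr_ex : [exists B in orb N (x ^+ j), adj Gam (S :* x ^+ i) B]
    = (x ^+ i.+1 == x ^+ j) || (x ^+ j.+1 == x ^+ i).
  apply/exists_inP/orP => [[B jB] | ].
    rewrite adj_nbrs // => iB; move: iB jB; rewrite !inE => /or4P[] /eqP->.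
    - by rewrite nbr_next //; left.
    - by rewrite nbr_next ?groupV //; left.
    - by rewrite nbr_prev //; right.
    by rewrite nbr_prev ?groupV //; right.
  case; [rewrite -(nbr_next n Nn) | rewrite -(nbr_prev n Nn)] => jB;
    by eexists; [exact: jB | rewrite adj_nbrs // !inE eqxx ?orbT].
have ordSE (k l : 'I_r) : (x ^+ k.+1 == x ^+ l) = (ordS k == l).
  by rewrite eq_expg_mod_order (modn_small (ltn_ord l)) -val_eqE.
rewrite nbr_ex (orbit_rcoset_eq S nsNG) // LE x_expr_eqL !ordSE /=.
case ij: (x ^+ i == x ^+ j) => //=; move/eqP: ij => ij.
have ordS_neq (k l : 'I_r) : x ^+ k = x ^+ l -> (ordS k == l) = false.
  move=> kl; rewrite -ordSE -kl expgS -{2}[x ^+ k]mul1g (inj_eq (mulIg _)).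
  exact: negbTE.
by rewrite !ordS_neq.
Qed.

(* The kernel is the core of [S N], which is [N]: an element [s z] of that core,
   with [z] in [N], would have its conjugate by [x^-1] in [S N], and this
   conjugate is [x ^- 2] modulo [S] and [N]. *)
Let quotient_kernel_N : quotient_kernel Gam G 'Rs N = N :> {set gT}.
Proof.
apply/setP=> a; rewrite (mem_quotient_kernel S g nsNG) LE.
apply/andP/idP => [[Ga /forall_inP fix_a] | Na]; last first.
  have Ga := subsetP sNG a Na; split=> //; apply/forall_inP=> y Gy.
  by rewrite (subsetP sNL) // -[y in y * a]invgK -mulgA -conjgE memNJ ?groupV.
have := fix_a 1 (group1 G).
rewrite invg1 mulg1 mul1g -LE => /mulsgP[b z Sb Nz def_a].
case: (in_S Sb) => def_b; first by rewrite def_a def_b mul1g.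
have /(_ x Gx) := fix_a; rewrite def_a def_b mulgA LNr ?groupV //.
rewrite (conjgC x) xs -mulgA (groupMl _ (subsetP sSL s (cycle_id s))).
rewrite -invMg groupV.
by rewrite -expg2 L_cycle ?mem_cycle // (negPf x2_neq1).
Qed.

(* When [S M = G] the quotient is a single vertex, and when [M = 1] its valency
   is too large. *)
Let cyclic_mul_S (M : {group gT}) : cyclic_normal_quotient Gam G 'Rs M ->
  M <| G /\ S * M = S * N.
Proof.
case=> nsMG cycM; split=> //; have [M1 | ntM] := eqsVneq M 1.
  by case: (orb1_not_cycle M1 cycM).
case: (mul_S_normal nsMG ntM) => // SM; have := is_cycle_card cycM.
by rewrite (graph_isog_card (normal_quotient_full g nsMG SM)) cardsT card_ord.
Qed.

Let cyclic_eq_N (M : {group gT}) : cyclic_normal_quotient Gam G 'Rs M ->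
  normal_quotient Gam 'Rs M = normal_quotient Gam 'Rs N.
Proof. by case/cyclic_mul_S=> nsMG; apply: eq_normal_quotient. Qed.

Let kernel_eq_N (M : {group gT}) : cyclic_normal_quotient Gam G 'Rs M ->
  quotient_kernel Gam G 'Rs M = N :> {set gT}.
Proof.
by move/cyclic_eq_N=> eqMN; rewrite -quotient_kernel_N /quotient_kernel eqMN.
Qed.

(** [Gamma_N], with kernel [N], is the only cyclic normal quotient, so that no two
    are independent. *)
Lemma basic_unoriented_cycle_type_coset_graph :
  basic_unoriented_cycle_type Gam G 'Rs.
Proof.
have cycN : is_cycle (normal_quotient Gam 'Rs N).
  by exists r => //; apply: normal_quotient_N.
split.
- split=> [|M nsMG ntM]; first exact: OG4_coset_graph.
  case: (mul_S_normal nsMG ntM) => SM.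
    by apply: Or31; apply: normal_quotient_full.
  by apply: Or33; rewrite (eq_normal_quotient g nsMG nsNG SM).
- by exists N.
- move=> M K /kernel_eq_N KM /kernel_eq_N KK; case.
  by rewrite KM KK setIid.
move=> M cycM; exists r; split=> //.
  by rewrite cyclic_eq_N //; apply: normal_quotient_N.
rewrite kernel_eq_N //.
apply: isog_trans (odd_dihedral_isog r_odd x_neq1 os xs).
by rewrite isog_sym (sdprod_isog defG).
Qed.

Lemma min_normal_subgroup_N (M : {group gT}) :
  min_normal_subgroup G M <-> M = N.
Proof.
have ntN : N :!=: 1.
  by apply: contraNneq n2 => N1; move: Nn; rewrite N1 => /set1gP->; rewrite mulg1.
split=> [[nsMG /mingroupP[/andP[ntM _] minM]] | ->].
  apply/esym/val_inj/minM; last exact: sub_normal.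
  by rewrite ntN normal_norm.
split=> //; apply/mingroupP; split; first by rewrite ntN normal_norm.
move=> K /andP[ntK nKG] sKN; apply/eqP; rewrite eqEsubset sKN sub_normal //.
by rewrite /normal (subset_trans sKN).
Qed.
End DihedralExtension.

(** * The semidirect product *)

(** [<[x]>] is an [r]-group acting on [M] by conjugation, where it fixes only the
    identity; so the order [p ^ j] of [M] is 1 modulo [r], and [k] divides [j]. *)
Lemma primitive_root_irreducible (gT : finGroupType) (N M : {group gT}) (x : gT)
    (p r k : nat) :
    prime p -> prime r -> #[x] = r -> #|N| = (p ^ k)%N ->
    (k.-primitive_root (p%:R : 'F_r))%R -> 'C_N[x] = 1 ->
  M \subset N -> x \in 'N(M) -> M :=: 1 \/ M :=: N.
Proof.
move=> p_prime r_prime ox cardN prim regN sMN nMx.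
have /(dvdn_pfactor _ _ p_prime)[j le_jk cardM] : #|M| %| p ^ k.
  by rewrite -cardN cardSg.
have x_grp : r.-group <[x]> by rewrite /pgroup -orderE ox pnat_id.
have actM : [acts <[x]>, on M | 'J] by rewrite astabsJ cycle_subG.
have := pgroup_fix_mod x_grp actM; rewrite afixJ cent_cycle.
have -> : 'C_M[x] = 1 by apply/trivgP; rewrite -regN setSI.
rewrite cards1 cardM => pj1.
have /eqP : ((p%:R : 'F_r) ^+ j)%R = 1%R.
  by rewrite -natrX -[LHS](Fp_nat_mod r_prime) pj1 Fp_nat_mod.
rewrite -(prim_order_dvd prim) => k_dvd_j.
case: (posnP j) => [j0 | j_gt0]; [left | right].
  by apply/eqP; rewrite trivg_card1 cardM j0.
apply/eqP; rewrite eqEcard sMN cardM cardN leq_exp2l ?prime_gt1 //.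
exact: dvdn_leq.
Qed.

Section Construction.
Variables p r : nat.
Hypotheses (p_prime : prime p) (r_prime : prime r).
Hypotheses (p_odd : odd p) (r_odd : odd r).
Local Notation inN := (sdpair1 (rowact p r)).
Local Notation inH := (sdpair2 (rowact p r)).

Let r_gt1 : 1 < r. Proof. exact: prime_gt1. Qed.
Let r_gt2 : 2 < r. Proof. exact: odd_prime_gt2. Qed.
Let r2_gt0 : 0 < r.-2. Proof. by rewrite -subn2 subn_gt0. Qed.
Let r_eq : r.-2.+2 = r. Proof. by rewrite -!subn2 -addn2 subnK. Qed.

Let two_neq0 : (1 + 1 : 'F_p)%R != 0%R.
Proof.
rewrite -[(1 + 1)%R]/(2%:R)%R -(dvdn_pcharf (pchar_Fp p_prime)).
by rewrite gtnNdvd // odd_prime_gt2.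
Qed.

Lemma sigma_in_Hgrp : sigma p r \in Hgrp p r.
Proof. by rewrite mem_gen // !inE eqxx. Qed.

Lemma phi_in_Hgrp : phi p r \in Hgrp p r.
Proof. by rewrite mem_gen // !inE eqxx orbT. Qed.

Lemma rowactE v a : rowact p r v a = (v *m val a)%R.
Proof. by rewrite /= mx_repr_actE ?inE. Qed.

Lemma nvec_unit_row : nvec p r = unit_row 'F_p r.-2 0.
Proof. by apply/rowP=> j; rewrite !mxE eqxx -val_eqE. Qed.

Lemma nvec_sigma :
  (nvec p r *m sigma_mx 'F_p r.-2 = nvec p r *m phi_mx 'F_p r.-2)%R.
Proof. by rewrite nvec_unit_row unit_row_sigma0 unit_row_phi // subn0. Qed.

Lemma phi_order : #[phi p r] = 2.
Proof.
apply: nt_prime_order => //; first by apply/val_inj; apply: phi_mx_sqr.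
apply/eqP=> /(congr1 val)/(congr1 (fun A => nvec p r *m A)%R).
rewrite [in RHS]/= mulmx1 /= nvec_unit_row unit_row_phi // subn0.
move/rowP/(_ ord0); rewrite !mxE /= [0 == _]ltn_eqF //.
by rewrite oppr0 => /esym/eqP; rewrite oner_eq0.
Qed.

Lemma sigma_order : #[sigma p r] = r.
Proof.
apply: nt_prime_order => //.
  apply/val_inj; rewrite FinRing.val_unitX /=.
  by have := sigma_mx_expr 'F_p r.-2; rewrite r_eq.
apply/eqP=> /(congr1 val)/(congr1 (fun A => nvec p r *m A)%R).
rewrite [in RHS]/= mulmx1 /= nvec_unit_row unit_row_sigma0.
move/rowP/(_ ord0); rewrite !mxE /= [0 == _]ltn_eqF //.
by rewrite oppr0 => /esym/eqP; rewrite oner_eq0.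
Qed.

Lemma sigma_phi : sigma p r ^ phi p r = (sigma p r)^-1.
Proof.
have phiV : (phi p r)^-1 = phi p r.
  by apply/eqP; rewrite eq_invg_mul; apply/eqP/val_inj; apply: phi_mx_sqr.
apply/eqP; rewrite eq_sym eq_invg_mul conjgE phiV !mulgA; apply/eqP/val_inj.
by rewrite -[RHS](sigma_phi_mx_sqr 'F_p r.-2) /= !mulmxE !mulrA.
Qed.

Lemma Hgrp_isog : Hgrp p r \isog [set: 'D_(r.*2)].
Proof.
have := @odd_dihedral_isog _ (sigma p r) (phi p r).
rewrite -order_gt1 sigma_order => -> //; [exact: phi_order | exact: sigma_phi].
Qed.

Local Notation n := (inN (nvec p r)).
Local Notation x := (inH (sigma p r)).
Local Notation s := (inH (phi p r)).

Lemma inH_Hgrp : inH @* Hgrp p r = <<[set x; s]>>.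
Proof.
rewrite morphim_gen ?subset_gen // morphimU.
by rewrite !morphim_set1 ?sigma_in_Hgrp ?phi_in_Hgrp.
Qed.

Lemma sdprod_Ngrp : Ngrp p r ><| <<[set x; s]>> = Ggrp p r.
Proof. by rewrite -inH_Hgrp; apply: sdprod_sdpair. Qed.

Lemma inH_order a : a \in Hgrp p r -> #[inH a] = #[a].
Proof. by move=> Ha; rewrite order_injm ?injm_sdpair2. Qed.

Lemma inN_conj v a : a \in Hgrp p r -> inN v ^ inH a = inN (v *m val a)%R.
Proof. by move=> Ha; rewrite -sdpair_act ?in_setT // rowactE. Qed.

Lemma inN_inj : injective inN.
Proof. by move=> u v; apply: (injmP (injm_sdpair1 _)); rewrite inE. Qed.

Lemma NgrpP u : reflect (exists v, u = inN v) (u \in Ngrp p r).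
Proof.
apply: (iffP idP) => [/morphimP[v _ _ ->] | [v ->]]; first by exists v.
by rewrite mem_morphim ?in_setT.
Qed.

Lemma card_Ngrp : #|Ngrp p r| = (p ^ r.-1)%N.
Proof.
rewrite card_injm ?injm_sdpair1 // cardsT card_mx card_Fp // mul1n.
by rewrite -[in RHS]r_eq.
Qed.

Lemma Ngrp_isog : Ngrp p r \isog [set: 'rV['F_p]_(r.-1)].
Proof.
have -> : r.-1 = r.-2.+1 by rewrite -[in LHS]r_eq.
by rewrite isog_sym sub_isog ?injm_sdpair1.
Qed.

Lemma Ngrp_abelian : abelian (Ngrp p r).
Proof. exact/morphim_abelian/FinRing.zmod_abelian. Qed.

(** A row fixed by [sigma] is killed by [r], which is invertible modulo [p]. *)
Lemma Ngrp_regular : p != r -> 'C_(Ngrp p r)[x] = 1.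
Proof.
move=> p'r; apply/trivgP/subsetP=> _ /setIP[/NgrpP[v ->] /cent1P cvx].
have /inN_inj/sigma_mx_fix : inN (v *m val (sigma p r))%R = inN v.
  by rewrite -inN_conj ?sigma_in_Hgrp //; apply/conjg_fixP/commgP/commute_sym.
rewrite r_eq -scaler_nat => /eqP; rewrite scaler_eq0 => /orP[] /eqP v0.
  have := dvdn_pcharf (pchar_Fp p_prime) r.
  by rewrite v0 eqxx dvdn_prime2 // (negPf p'r).
by rewrite v0 morph1 set11.
Qed.

Lemma Ngrp_faithful : 'C_(<<[set x; s]>>)(Ngrp p r) = 1.
Proof.
apply/trivgP/subsetP=> h /setIP[+ /centP cNa].
rewrite /= -inH_Hgrp => /morphimP[a _ Ha def_h]; move: cNa; rewrite def_h => cNa.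
suff -> : a = 1 by rewrite morph1 set11.
apply/val_inj/unit_row_eq => k _; rewrite mulmx1; apply: inN_inj.
rewrite -inN_conj //; apply/conjg_fixP/commgP/commute_sym/cNa.
by apply/NgrpP; eexists.
Qed.

Lemma nvec_sqr_neq1 : n * n != 1.
Proof.
rewrite -morphM ?inE // -(morph1 (sdpair1_morphism _)) (inj_eq inN_inj).
apply: contraNneq two_neq0 => /rowP/(_ ord0).
by rewrite !mxE eqxx => ->.
Qed.
End Construction.

Theorem lemma7p7 (p r : nat) (p_prime : prime p) (r_prime : prime r)
    (p_odd : odd p) (r_odd : odd r) (p_lt_r : (p < r)%N)
    (p_prim : ((r.-1).-primitive_root (p%:R : 'F_r))%R) :
  [/\ (Hgrp p r \isog 'D_(r.*2))%g,
      (Sgrp p r \isog Zp 2)%g,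
      OG4 (Gamma p r) (Ggrp p r) 'Rs,
      basic_unoriented_cycle_type (Gamma p r) (Ggrp p r) 'Rs
    & [/\ forall M : {group gtype p r},
            min_normal_subgroup (Ggrp p r) M <-> M = Ngrp p r,
          (Ngrp p r \isog [set: 'rV['F_p]_(r.-1)])%g
        & graph_isog (normal_quotient (Gamma p r) 'Rs (Ngrp p r))
                     (cycle_graph r)]].
Proof.
set x := sdpair2 (rowact p r) (sigma p r).
set s := sdpair2 (rowact p r) (phi p r).
set n := sdpair1 (rowact p r) (nvec p r).
have [sigmaH phiH] := (sigma_in_Hgrp p r, phi_in_Hgrp p r).
have ox : #[x] = r by rewrite inH_order // sigma_order.
have os : #[s] = 2 by rewrite inH_order // phi_order.
have x_prime : prime #[x] by rewrite ox.
have x_odd : odd #[x] by rewrite ox.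
have xs : x ^ s = x^-1 by rewrite -morphJ // sigma_phi // morphV.
have defG := sdprod_Ngrp p r.
have Nn : n \in Ngrp p r by apply/NgrpP; exists (nvec p r).
have ns : n ^ s = n ^ x by rewrite !inN_conj // nvec_sigma.
have n2 := nvec_sqr_neq1 r p_prime p_odd.
have cNN := Ngrp_abelian p r.
have faithN := Ngrp_faithful p r.
have irrN (M : {group gtype p r}) : M \subset Ngrp p r -> x \in 'N(M) ->
    M :=: 1 \/ M :=: Ngrp p r.
  have p'r : p != r by rewrite ltn_eqF.
  exact: primitive_root_irreducible p_prime r_prime ox
    (card_Ngrp p_prime r_prime) p_prim (Ngrp_regular p_prime r_prime p'r).
split.
- exact: Hgrp_isog.
- by rewrite /Sgrp -os isog_sym; apply: Zp_isog.
- exact (OG4_coset_graph defG x_prime x_odd os xs cNN Nn ns n2 irrN).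
- exact (basic_unoriented_cycle_type_coset_graph defG x_prime x_odd os xs
    cNN Nn ns n2 faithN irrN).
split; first exact (min_normal_subgroup_N defG cNN Nn n2 faithN irrN).
  exact: Ngrp_isog.
by have := normal_quotient_N defG x_prime x_odd os xs Nn ns; rewrite ox.
Qed.
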